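(* Assume: (i) $f:\mathbb{R}^{n+1}\to\mathbb{R}$ is twice continuously differentiable, $L$-smooth, and bounded below on $\mathbb{R}^{n+1}$; (ii) the step sizes $\alpha_k$ satisfy the strong Wolfe conditions with parameters $0<c_1<c_2<1$; (iii) the YAND directions are T-bounded: there is $T<\infty$ with $T_k=\|\tau_k\|\le T$ for all $k$ (so that $\cos\theta_k\ge c>0$ for all $k$, with $c=1/\sqrt{1+T^2}$). Let $f^\star:=\inf_{x\in\mathbb{R}^{n+1}}f(x)$. Then the YAND iterates $x_{k+1}=x_k+\alpha_kd_k$ satisfy $$\sum_{k=0}^\infty\cos^2\theta_k\,\|\nabla f(x_k)\|^2<\infty,\qquad\text{and hence}\qquad\|\nabla f(x_k)\|\to0.$$ Moreover, $$\min_{0\le j<K}\|\nabla f(x_j)\|\le\frac{C}{\sqrt K},\qquad C=\sqrt{\frac{L(f(x_0)-f^\star)}{c_1(1-c_2)c^2}}.$$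
   Context: $L$-smooth means $\|\nabla f(x)-\nabla f(y)\|\le L\|x-y\|$ for all $x,y$. The function $f$ is sufficiently smooth for the affine normals below to be defined at the iterates, and $\nabla f(x_k)\neq0$ for all $k$ (otherwise the iteration stops). YAND direction. At $x_k$ put $e_{n+1}=\nabla f(x_k)/\|\nabla f(x_k)\|$ and let $e_1,\dots,e_n$ be an orthonormal basis of $\nabla f(x_k)^\perp$ (normal-aligned frame). With $f_{ij}=D^2f(x_k)[e_i,e_j]$, $f_{n+1,i}=D^2f(x_k)[e_{n+1},e_i]$, $f_{pqi}=D^3f(x_k)[e_p,e_q,e_i]$ ($i,j,p,q\le n$) and $(f^{ij})$ the inverse of $(f_{ij})_{i,j\le n}$, the affine normal direction is, up to a nonzero scalar, $d_{\mathrm{AN}}(x_k)\propto\sum_i\big(\sum_jf^{ij}(-\frac1{n+2}\|\nabla f(x_k)\|\sum_{p,q}f^{pq}f_{pqj}+f_{n+1,j})\big)e_i-e_{n+1}$. The direction $d_k$ is $d_{\mathrm{AN}}(x_k)$ if $\langle\nabla f(x_k),d_{\mathrm{AN}}(x_k)\rangle<0$, $-d_{\mathrm{AN}}(x_k)$ if this inner product is $>0$, and $-\nabla f(x_k)/\|\nabla f(x_k)\|$ otherwise; it is scaled so that $d_k=\sum_{i=1}^n(\tau_k)_ie_i-e_{n+1}$ with $\tau_k\in\mathbb{R}^n$, and $T_k:=\|\tau_k\|$. $\theta_k\in[0,\pi]$ is the angle between $-\nabla f(x_k)$ and $d_k$: $\cos\theta_k=-\langle\nabla f(x_k),d_k\rangle/(\|\nabla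 f(x_k)\|\|d_k\|)$. Strong Wolfe conditions: $f(x_k+\alpha_kd_k)\le f(x_k)+c_1\alpha_k\nabla f(x_k)^\top d_k$ and $|\nabla f(x_k+\alpha_kd_k)^\top d_k|\le c_2|\nabla f(x_k)^\top d_k|$, with $\alpha_k>0$. *)

(* Defs.v *)
From HB Require Import structures.
From mathcomp Require Import all_boot all_order all_algebra.
From mathcomp Require Import all_classical all_reals all_analysis.
Set Implicit Arguments.
Unset Strict Implicit.
Unset Printing Implicit Defensive.
Import Order.TTheory GRing.Theory Num.Theory.
Import numFieldNormedType.Exports.
Local Open Scope classical_set_scope.
Local Open Scope ring_scope.

(* The library norm on row vectors is the sup norm, so the Euclidean inner
   product and norm are introduced here; the sup norm is used only through the
   topology it induces, which is the Euclidean one. *)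
Definition dotp (R : realType) (m : nat) (u v : 'rV[R]_m) : R :=
  \sum_(i < m) u 0 i * v 0 i.

Definition enorm (R : realType) (m : nat) (u : 'rV[R]_m) : R :=
  Num.sqrt (dotp u u).

Definition angle (R : realType) (m : nat) (u v : 'rV[R]_m) : R :=
  acos (dotp u v / (enorm u * enorm v)).

Section calculus.
Variables (R : realType) (n : nat).
Implicit Types (f : 'rV[R]_n.+1 -> R) (x u v w : 'rV[R]_n.+1) (L : R).

Definition grad f x : 'rV[R]_n.+1 := \row_i 'D_(delta_mx 0 i) f x.

Definition D2 f x u v : R := 'D_u (fun y => 'D_v f y) x.

Definition D3 f x u v w : R := 'D_u (fun y => D2 f y v w) x.

Definition twice_continuously_differentiable f : Prop :=
  [/\ forall x, differentiable f x,
      forall v x, differentiable (fun y => 'D_v f y) x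
    & forall u v, continuous (fun x => D2 f x u v)].

Definition hessian_differentiable_at f x : Prop :=
  forall u v, differentiable (fun y => D2 f y u v) x.

Definition L_smooth L f : Prop :=
  forall x y, enorm (grad f x - grad f y) <= L * enorm (x - y).

Definition strong_wolfe (c1 c2 : R) f x d (alpha : R) : Prop :=
  [/\ 0 < alpha,
      f (x + alpha *: d) <= f x + c1 * alpha * dotp (grad f x) d
    & `|dotp (grad f (x + alpha *: d)) d| <= c2 * `|dotp (grad f x) d| ].

End calculus.

Section affine_normal.
Variables (R : realType) (n : nat).
Variables (f : 'rV[R]_n.+1 -> R) (x : 'rV[R]_n.+1) (e : 'I_n -> 'rV[R]_n.+1).

Definition unit_grad : 'rV[R]_n.+1 := (enorm (grad f x))^-1 *: grad f x.

(* [n] orthonormal vectors of the hyperplane orthogonal to the gradient are a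
   basis of it; the last vector of the frame is [unit_grad]. *)
Definition normal_aligned_frame : Prop :=
  (forall i j, dotp (e i) (e j) = (i == j)%:R) /\
  (forall i, dotp (e i) (grad f x) = 0).

Definition tangent_hessian : 'M[R]_n := \matrix_(i, j) D2 f x (e i) (e j).

(* Component [i] is
   sum_j f^{ij} (- 1/(n+2) |grad f| sum_{p,q} f^{pq} f_{pqj} + f_{n+1,j}). *)
Definition affine_normal_tangent (i : 'I_n) : R :=
  let H' := invmx tangent_hessian in
  \sum_(j < n) H' i j *
    (- (n.+2%:R^-1 * enorm (grad f x) *
        \sum_(p < n) \sum_(q < n) H' p q * D3 f x (e p) (e q) (e j))
     + D2 f x unit_grad (e j)).

(* [invmx] is total, so invertibility is required explicitly. *)
Definition affine_normal_direction (d : 'rV[R]_n.+1) : Prop :=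
  tangent_hessian \in unitmx /\
  exists2 s : R, s != 0 &
    d = s *: (\sum_(i < n) affine_normal_tangent i *: e i - unit_grad).

(* The last case is "otherwise": no affine normal direction has a nonzero inner
   product with the gradient, in particular when none exists because the
   tangential Hessian is singular. *)
Inductive yand_unscaled : 'rV[R]_n.+1 -> Prop :=
| YandKeep dAN : affine_normal_direction dAN ->
    dotp (grad f x) dAN < 0 -> yand_unscaled dAN
| YandFlip dAN : affine_normal_direction dAN ->
    0 < dotp (grad f x) dAN -> yand_unscaled (- dAN)
| YandFallback :
    (forall dAN, affine_normal_direction dAN -> dotp (grad f x) dAN = 0) ->
    yand_unscaled (- unit_grad).

Definition yand_direction (tau : 'rV[R]_n) (d : 'rV[R]_n.+1) : Prop :=
  (exists d' : 'rV[R]_n.+1, yand_unscaled d' /\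
     exists2 r : R, 0 < r & d = r *: d') /\
  d = \sum_(i < n) tau 0 i *: e i - unit_grad.

End affine_normal.

(* Main.v *)
(* This is Zoutendijk's argument. Since [d] has normal component [-1] and
   tangential part [tau], [cos theta = 1 / sqrt (1 + |tau|^2) >= c]. The
   curvature condition and the Lipschitz bound on the gradient force a step of
   length at least [(1 - c2) |g.d| / (L |d|^2)], so sufficient decrease gives
   [c1 (1 - c2) cos^2 theta |g|^2 <= L (f x_k - f x_{k+1})]; telescoping bounds
   the series, and the limit and the rate follow from the lower bound on the
   cosine. *)
Require Import Defs.
From mathcomp Require Import all_boot all_order all_algebra.
From mathcomp Require Import ring lra.
From mathcomp Require Import all_classical all_reals all_analysis.
Set Implicit Arguments.
Unset Strict Implicit.
Unset Printing Implicit Defensive.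
Import Order.TTheory GRing.Theory Num.Theory.
Import numFieldNormedType.Exports.
Local Open Scope classical_set_scope.
Local Open Scope ring_scope.

(** * Euclidean inner product, norm and angle *)

Section euclidean.
Variables (R : realType) (m : nat).
Implicit Types (u v w : 'rV[R]_m) (a : R).

Lemma dotpC u v : dotp u v = dotp v u.
Proof. by apply: eq_bigr => i _; rewrite mulrC. Qed.

Lemma dotpDl u v w : dotp (u + v) w = dotp u w + dotp v w.
Proof. by rewrite -big_split; apply: eq_bigr => i _; rewrite mxE mulrDl. Qed.

Lemma dotpZl a u v : dotp (a *: u) v = a * dotp u v.
Proof. by rewrite mulr_sumr; apply: eq_bigr => i _; rewrite mxE mulrA. Qed.

Lemma dotpNl u v : dotp (- u) v = - dotp u v.
Proof. by rewrite -scaleN1r dotpZl mulN1r. Qed.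

Lemma dotpBl u v w : dotp (u - v) w = dotp u w - dotp v w.
Proof. by rewrite dotpDl dotpNl. Qed.

Lemma dotpZr a u v : dotp u (a *: v) = a * dotp u v.
Proof. by rewrite dotpC dotpZl dotpC. Qed.

Lemma dotpNr u v : dotp u (- v) = - dotp u v.
Proof. by rewrite dotpC dotpNl dotpC. Qed.

Lemma dotpBr u v w : dotp u (v - w) = dotp u v - dotp u w.
Proof. by rewrite dotpC dotpBl dotpC (dotpC w). Qed.

Lemma dotp_suml (I : finType) (F : I -> 'rV[R]_m) v :
  dotp (\sum_i F i) v = \sum_i dotp (F i) v.
Proof.
apply: (big_morph (fun u => dotp u v)) => [u w|]; first exact: dotpDl.
by rewrite -(scale0r 0) dotpZl mul0r.
Qed.

Lemma dotp_ge0 u : 0 <= dotp u u.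
Proof. by apply: sumr_ge0 => i _; rewrite -expr2 sqr_ge0. Qed.

Lemma dotp_eq0 u : (dotp u u == 0) = (u == 0).
Proof.
apply/idP/eqP => [|->]; last by rewrite -(scale0r 0) dotpZl mul0r.
rewrite psumr_eq0 => [/allP u0|i _]; last by rewrite -expr2 sqr_ge0.
apply/rowP => i; rewrite mxE; apply/eqP.
by have := u0 i (mem_index_enum i); rewrite mulf_eq0 orbb.
Qed.

Lemma enorm_ge0 u : 0 <= enorm u.
Proof. exact: sqrtr_ge0. Qed.

Lemma enorm_gt0 u : (0 < enorm u) = (u != 0).
Proof. by rewrite sqrtr_gt0 lt_def dotp_ge0 andbT dotp_eq0. Qed.

Lemma enorm_sqr u : enorm u ^+ 2 = dotp u u.
Proof. by rewrite sqr_sqrtr ?dotp_ge0. Qed.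

Lemma enormN u : enorm (- u) = enorm u.
Proof. by rewrite /enorm dotpNl dotpNr opprK. Qed.

Lemma enormZ a u : enorm (a *: u) = `|a| * enorm u.
Proof.
by rewrite /enorm dotpZl dotpZr mulrA -expr2 sqrtrM ?sqr_ge0// sqrtr_sqr.
Qed.

(** For nonzero [v], the squared norm of [dotp v v *: u - dotp u v *: v] equals [dotp v v] times the
    gap between the squared sides, so that gap is nonnegative. *)
Lemma cauchy_schwarz u v : `|dotp u v| <= enorm u * enorm v.
Proof.
have [->|v0] := eqVneq v 0.
  by rewrite -(scale0r 0) dotpZr mul0r normr0 mulr_ge0 ?enorm_ge0.
rewrite -(@ler_pXn2r _ 2) ?nnegrE ?mulr_ge0 ?enorm_ge0//.
rewrite exprMn !enorm_sqr real_normK ?num_real//.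
have v_gt0 : 0 < dotp v v by rewrite lt_def dotp_ge0 dotp_eq0 v0.
have := dotp_ge0 (dotp v v *: u - dotp u v *: v).
rewrite dotpBl !dotpBr !dotpZl !dotpZr (dotpC v u) => h.
rewrite -subr_ge0 -(pmulr_rge0 _ v_gt0); lra.
Qed.

(** Cauchy-Schwarz puts the quotient in [-1, 1], where [acos] is a right inverse of [cos]. For a
    zero vector the convention [0^-1 = 0] makes the quotient 0. *)
Lemma cos_angle u v : cos (angle u v) = dotp u v / (enorm u * enorm v).
Proof.
have N0 : 0 <= enorm u * enorm v by rewrite mulr_ge0 ?enorm_ge0.
rewrite /angle acosK// in_itv/= -ler_norml normrM normfV (ger0_norm N0).
have [->|N_neq0] := eqVneq (enorm u * enorm v) 0; first by rewrite invr0 mulr0.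
by rewrite ler_pdivrMr ?mul1r ?cauchy_schwarz// lt_def N_neq0.
Qed.

End euclidean.

(** * Zoutendijk's inequality for strong Wolfe steps *)

Section zoutendijk.
Variables (R : realType) (n : nat) (f : 'rV[R]_n.+1 -> R) (L c1 c2 : R).
Hypotheses (f_smooth : L_smooth L f) (c1_gt0 : 0 < c1) (c2_lt1 : c2 < 1).

Lemma wolfe_decrease (x d : 'rV[R]_n.+1) (a : R) :
  strong_wolfe c1 c2 f x d a -> dotp (grad f x) d < 0 ->
  c1 * (1 - c2) * dotp (grad f x) d ^+ 2
    <= L * enorm d ^+ 2 * (f x - f (x + a *: d)).
Proof.
case=> a_gt0 decr curv gd_lt0.
set s := dotp (grad f x) d in decr curv gd_lt0 *.
(* Both sides bound the increment of the gradient along [d]: the curvature condition from below,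
   Cauchy-Schwarz with the Lipschitz bound from above. *)
have step_ge : (1 - c2) * - s <= a * (L * enorm d ^+ 2).
  have := f_smooth (x + a *: d) x.
  rewrite addrAC subrr add0r enormZ gtr0_norm// => lip.
  have := cauchy_schwarz (grad f (x + a *: d) - grad f x) d.
  move/(le_trans (ler_norm _)).
  move/le_trans => /(_ _ (ler_wpM2r (enorm_ge0 d) lip)).
  rewrite dotpBl -/s => h.
  move: curv; rewrite ler_norml (ltr0_norm gd_lt0) => /andP[h' _].
  by rewrite expr2; lra.
(* The sign of [L] is not given; it is read off [step_ge], whose left side is nonnegative. *)
have Ld_ge0 : 0 <= L * enorm d ^+ 2.
  rewrite -(pmulr_rge0 _ a_gt0) (le_trans _ step_ge)//.
  by rewrite mulr_ge0// ltW// ?subr_gt0 ?oppr_gt0.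
have h1 : c1 * a * - s <= f x - f (x + a *: d) by lra.
have h2 := ler_wpM2l Ld_ge0 h1.
(* [step_ge] times [c1 * - s]; its right side is also the left side of [h2], so the two bounds
   chain. *)
have h3 : c1 * - s * ((1 - c2) * - s) <= c1 * - s * (a * (L * enorm d ^+ 2)).
  by rewrite ler_wpM2l// mulr_ge0 ?ltW// oppr_gt0.
lra.
Qed.

Lemma zoutendijk_sum (x d : nat -> 'rV[R]_n.+1) (a : nat -> R) (b : R) :
    (forall y, b <= f y) ->
    (forall k, strong_wolfe c1 c2 f (x k) (d k) (a k)) ->
    (forall k, x k.+1 = x k + a k *: d k) ->
    (forall k, dotp (grad f (x k)) (d k) < 0) ->
  forall K, \sum_(0 <= k < K)
      (cos (angle (- grad f (x k)) (d k)) ^+ 2 * enorm (grad f (x k)) ^+ 2)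
    <= L * (f (x 0%N) - b) / (c1 * (1 - c2)).
Proof.
move=> f_ge wolfe x_step gd_lt0 K.
have C_gt0 : 0 < c1 * (1 - c2) by rewrite mulr_gt0 ?subr_gt0.
have d_neq0 k : d k != 0.
  apply: contraTneq (gd_lt0 k) => ->.
  by rewrite -(scale0r 0) dotpZr mul0r ltxx.
have g_neq0 k : grad f (x k) != 0.
  apply: contraTneq (gd_lt0 k) => ->.
  by rewrite -(scale0r 0) dotpZl mul0r ltxx.
have term_le k :
    c1 * (1 - c2) *
      (cos (angle (- grad f (x k)) (d k)) ^+ 2 * enorm (grad f (x k)) ^+ 2)
    <= L * (f (x k) - f (x k.+1)).
  have d_gt0 : 0 < enorm (d k) by rewrite enorm_gt0.
  have g_gt0 : 0 < enorm (grad f (x k)) by rewrite enorm_gt0.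
  have := wolfe_decrease (wolfe k) (gd_lt0 k); rewrite -x_step => h.
  (* Multiplying by the squared norm of [d k] turns the left side into [c1 * (1 - c2)] times the
     squared directional derivative, as in [wolfe_decrease]. *)
  rewrite -(ler_pM2r (exprn_gt0 2 d_gt0)) cos_angle dotpNl enormN.
  rewrite [leRHS]mulrAC; apply: le_trans h.
  by rewrite [leLHS](_ : _ = c1 * (1 - c2) * dotp (grad f (x k)) (d k) ^+ 2)//;
    field; rewrite !gt_eqF.
(* The first step is nonzero, so the Lipschitz bound between the first two iterates forces this
   sign. *)
have L_ge0 : 0 <= L.
  have d_gt0 : 0 < enorm (a 0%N *: d 0%N).
    have [a_gt0 _ _] := wolfe 0%N.
    by rewrite enorm_gt0 scaler_eq0 negb_or gt_eqF//=.
  have := f_smooth (x 1%N) (x 0%N); rewrite x_step addrAC subrr add0r.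
  by move/(le_trans (enorm_ge0 _)); rewrite pmulr_lge0.
rewrite ler_pdivlMr// mulrC mulr_sumr.
apply: le_trans (ler_sum _ (fun k _ => term_le k)) _.
rewrite -mulr_sumr ler_wpM2l// (eq_bigr (fun k => - f (x k.+1) - - f (x k))).
  by rewrite telescope_sumr// opprK addrC lerB.
by move=> k _; rewrite opprK addrC.
Qed.

End zoutendijk.

(** * Length and angle of a YAND direction in the normal-aligned frame *)

Section yand.
Variables (R : realType) (n : nat) (f : 'rV[R]_n.+1 -> R) (x : 'rV[R]_n.+1).
Variables (e : 'I_n -> 'rV[R]_n.+1) (tau : 'rV[R]_n) (d : 'rV[R]_n.+1).
Hypotheses (grad_neq0 : grad f x != 0) (e_frame : normal_aligned_frame f x e).
Hypothesis d_yand : yand_direction f x e tau d.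

Lemma dotp_grad_yand : dotp (grad f x) d = - enorm (grad f x).
Proof.
have [_ eg] := e_frame; have [_ ->] := d_yand.
have g_gt0 : enorm (grad f x) != 0 by rewrite gt_eqF// enorm_gt0.
rewrite dotpC dotpBl dotp_suml big1 => [|i _]; last by rewrite dotpZl eg mulr0.
by rewrite dotpZl -enorm_sqr expr2 mulrA mulVf// mul1r sub0r.
Qed.

Lemma enorm_yand : enorm d = Num.sqrt (1 + enorm tau ^+ 2).
Proof.
have [ee eg] := e_frame; have [_ dE] := d_yand.
have g_gt0 : enorm (grad f x) != 0 by rewrite gt_eqF// enorm_gt0.
rewrite {1}/enorm; congr Num.sqrt.
have ed j : dotp d (e j) = tau 0 j.
  rewrite dE dotpBl dotp_suml dotpZl dotpC eg mulr0 subr0 (bigD1 j)//=.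
  rewrite dotpZl ee eqxx mulr1 big1 ?addr0// => i /negPf ij.
  by rewrite dotpZl ee ij mulr0.
(* Only the left factor of [dotp d d] is expanded: its normal part contributes 1, its tangential
   part the squared norm of [tau]. *)
rewrite {1}dE dotpBl dotp_suml dotpZl dotp_grad_yand mulrN mulVf// opprK.
rewrite addrC enorm_sqr; congr (_ + _); apply: eq_bigr => i _.
by rewrite dotpZl dotpC ed.
Qed.

Lemma cos_yand :
  cos (angle (- grad f x) d) = (Num.sqrt (1 + enorm tau ^+ 2))^-1.
Proof.
rewrite cos_angle dotpNl enormN dotp_grad_yand opprK -enorm_yand invfM mulrA.
by rewrite divff ?mul1r// gt_eqF// enorm_gt0.
Qed.

End yand.

(** * Nonnegative series with bounded partial sums *)

Lemma nneseries_lty (R : realType) (u : nat -> R) (B : R) :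
  (forall k, 0 <= u k) -> (forall K, \sum_(0 <= k < K) u k <= B) ->
  (\sum_(0 <= k <oo) (u k)%:E < +oo)%E.
Proof.
move=> u0 uB; apply: (@le_lt_trans _ _ B%:E); last exact: ltry.
apply: lime_le; first by apply: is_cvg_nneseries => k _ _; rewrite lee_fin.
by apply: nearW => K; rewrite sumEFin lee_fin.
Qed.

(** The partial sums are nondecreasing and bounded, so the series converges and its terms vanish in
    the limit. *)
Lemma bounded_sums_cvg0 (R : realType) (u : nat -> R) (B : R) :
  (forall k, 0 <= u k) -> (forall K, \sum_(0 <= k < K) u k <= B) ->
  u k @[k --> \oo] --> (0 : R).
Proof.
move=> u0 uB; apply: cvg_series_cvg_0; apply: nondecreasing_is_cvgn.
  by apply/nondecreasing_seqP => K; rewrite /series/= big_nat_recr//= lerDl.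
by exists B => _ [K _ <-]; exact: uB.
Qed.

Theorem theorem7p9 (R : realType) (n : nat) (f : 'rV[R]_n.+1 -> R)
    (L c1 c2 T : R)
    (x d : nat -> 'rV[R]_n.+1) (e : nat -> 'I_n -> 'rV[R]_n.+1)
    (tau : nat -> 'rV[R]_n) (alpha : nat -> R)
    (f_C2 : twice_continuously_differentiable f)
    (f_smooth : L_smooth L f)
    (f_bounded : has_lbound (range f))
    (f_D3 : forall k, hessian_differentiable_at f (x k))
    (grad_neq0 : forall k, grad f (x k) != 0)
    (e_frame : forall k, normal_aligned_frame f (x k) (e k))
    (d_yand : forall k, yand_direction f (x k) (e k) (tau k) (d k))
    (c1_gt0 : 0 < c1) (c1_lt_c2 : c1 < c2) (c2_lt1 : c2 < 1)
    (wolfe : forall k, strong_wolfe c1 c2 f (x k) (d k) (alpha k))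
    (x_step : forall k, x k.+1 = x k + alpha k *: d k)
    (T_bounded : forall k, enorm (tau k) <= T) :
  let theta := fun k => angle (- grad f (x k)) (d k) in
  let c := (Num.sqrt (1 + T ^+ 2))^-1 in
  let fstar := inf (range f) in
  let C := Num.sqrt (L * (f (x 0%N) - fstar) / (c1 * (1 - c2) * c ^+ 2)) in
  [/\ 0 < c /\ (forall k, c <= cos (theta k)),
      (\sum_(0 <= k <oo)
         (cos (theta k) ^+ 2 * enorm (grad f (x k)) ^+ 2)%:E < +oo)%E,
      enorm (grad f (x k)) @[k --> \oo] --> (0 : R)
    & forall K : nat, (0 < K)%N ->
        \big[Num.min/enorm (grad f (x 0%N))]_(0 <= j < K) enorm (grad f (x j))
          <= C / Num.sqrt K%:R].
Proof.
move=> theta c fstar C.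
have sq_gt0 (t : R) : 0 < Num.sqrt (1 + t ^+ 2).
  by rewrite sqrtr_gt0 ltr_wpDr ?sqr_ge0.
have c_gt0 : 0 < c by rewrite invr_gt0.
(* The map sending t to [(Num.sqrt (1 + t ^+ 2))^-1] decreases for nonnegative t, and [T] is
   nonnegative as a bound on norms. *)
have cos_ge k : c <= cos (theta k).
  rewrite (cos_yand (grad_neq0 k) (e_frame k) (d_yand k)) lef_pV2 ?posrE//.
  rewrite ler_wsqrtr// lerD2l ler_sqr ?nnegrE ?enorm_ge0//.
  exact: le_trans (enorm_ge0 _) (T_bounded k).
have f_ge y : fstar <= f y by apply: ge_inf => //; exists y.
have gd_lt0 k : dotp (grad f (x k)) (d k) < 0.
  by rewrite (dotp_grad_yand (grad_neq0 k) (e_frame k) (d_yand k)) oppr_lt0 enorm_gt0.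
set B := L * (f (x 0%N) - fstar) / (c1 * (1 - c2)).
have sum_le := zoutendijk_sum f_smooth c1_gt0 c2_lt1 f_ge wolfe x_step gd_lt0.
have sum_sqr_le K :
    \sum_(0 <= k < K) enorm (grad f (x k)) ^+ 2 <= B / c ^+ 2.
  rewrite ler_pdivlMr ?exprn_gt0// mulr_suml; apply: le_trans (sum_le K).
  apply: ler_sum => k _; rewrite mulrC ler_wpM2r ?sqr_ge0//.
  by rewrite ler_pXn2r ?nnegrE ?(ltW c_gt0) ?(le_trans (ltW c_gt0)) ?cos_ge.
split.
- by split.
- by apply: (nneseries_lty _ sum_le) => k; rewrite mulr_ge0 ?sqr_ge0.
(* The squared norms are summable, hence tend to 0; continuity of the square root transfers this to
   the norms. *)
- have -> : (fun k => enorm (grad f (x k))) =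
      Num.sqrt \o (fun k => enorm (grad f (x k)) ^+ 2).
    by apply/funext => k /=; rewrite sqrtr_sqr ger0_norm ?enorm_ge0.
  rewrite -(sqrtr0 R); apply: continuous_cvg; first exact: sqrt_continuous.
  exact: bounded_sums_cvg0 (fun k => sqr_ge0 _) sum_sqr_le.
- move=> K K_gt0.
  (* The default value of the minimum is its entry at [j = 0], which lies in the range as [K] is
     positive. *)
  set M := \big[_/_]_(_ <= _ < _) _.
  have M_ge0 : 0 <= M.
    by rewrite /M; apply: le_bigmin => [|j _]; exact: enorm_ge0.
  have M_le j : (j < K)%N -> M <= enorm (grad f (x j)).
    by move=> jK; rewrite /M big_mkord; exact: (bigmin_le _ (Ordinal jK)).
  have CE : C = Num.sqrt (B / c ^+ 2).
    by rewrite /C (invfM _ (c ^+ 2)) mulrA.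
  (* Each of the [K] summands in [sum_sqr_le] is at least [M ^+ 2]. *)
  have KM : M ^+ 2 * K%:R <= B / c ^+ 2.
    apply: le_trans (sum_sqr_le K); rewrite mulr_natr -[X in _ *+ X]subn0.
    rewrite -sumr_const_nat; apply: ler_sum_nat => j /andP[_ jK].
    by rewrite ler_sqr ?nnegrE ?enorm_ge0// M_le.
  have K0 : (0 : R) < K%:R by rewrite ltr0n.
  rewrite ler_pdivlMr ?sqrtr_gt0// CE -[M](ger0_norm M_ge0) -sqrtr_sqr.
  by rewrite -sqrtrM ?sqr_ge0// ler_wsqrtr.
Qed.
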